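(* Let $n\ge 2$ and let $G$ be a $\mathcal{C}_n$-symmetric graph with $\mathcal{C}_n$-symmetric constant distance closure $\operatorname{CDC}_{\mathcal{C}_n}(G)$. Then $G$ admits a proper $\mathcal{C}_n$-symmetric flexible placement if and only if $\operatorname{CDC}_{\mathcal{C}_n}(G)$ admits a proper $\mathcal{C}_n$-symmetric flexible placement. In particular, if $\operatorname{CDC}_{\mathcal{C}_n}(G)$ is a complete graph, then $G$ has no proper $\mathcal{C}_n$-symmetric flexible placement.
   Context: All graphs are finite and simple. Symmetric graphs. Let $n\ge 2$ and let $\mathcal{C}_n=\langle \omega : \omega^n=1\rangle$ be the cyclic group of order $n$. It acts on a graph $G$ via an injective group homomorphism $\theta:\mathcal{C}_n\to \operatorname{Aut}(G)$; write $\gamma v:=\theta(\gamma)(v)$ for $v\in V(G)$ and $\gamma e:=\gamma u\,\gamma v$ for $e=uv\in E(G)$. A vertex $v$ is invariant if $\gamma v=v$ for all $\gamma\in\mathcal{C}_n$, and partially invariant if $\gamma v=v$ for some $\gamma\in\mathcal{C}_n$, $\gamma\ne 1$. The graph $G$ (with this action) is $\mathcal{C}_n$-symmetric if every partially invariant vertex is invariant and the set of invariant vertices is an independent set of $G$. Frameworks. A placement of $G$ is a (possibly non-injective) map $p:V(G)\to\mathbb{R}^2$ with $p(u)\neq p(v)$ whenever $uv\in E(G)$; the pair $(G,p)$ is a framework. Frameworks $(G,p)$ and $(G,q)$ are equivalent if $\|p(u)-p(v)\|=\|q(u)-q(v)\|$ for all $uv\in E(G)$; placements $p,q$ are congruent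 if this equality holds for all $u,v\in V(G)$. A flex of $(G,p)$ is a continuous path $t\mapsto p_t$, $t\in[0,1]$, in the space of placements of $G$ with $p_0=p$ and each $(G,p_t)$ equivalent to $(G,p)$; it is trivial if $p_t$ is congruent to $p$ for all $t\in[0,1]$. For a $\mathcal{C}_n$-symmetric graph $G$, a placement $p$ is $\mathcal{C}_n$-symmetric if $p(\gamma v)=\tau(\gamma)p(v)$ for all $v\in V(G)$ and $\gamma=\omega^k\in\mathcal{C}_n$, where $\tau(\omega^k)$ is the rotation matrix by angle $2k\pi/n$. A $\mathcal{C}_n$-symmetric framework $(G,p)$ is proper $\mathcal{C}_n$-symmetric flexible (and $p$ is a proper $\mathcal{C}_n$-symmetric flexible placement of $G$) if it has a non-trivial flex $p_t$ consisting of $\mathcal{C}_n$-symmetric placements, all but finitely many of which are injective. Colourings. A NAC-colouring of $G$ is a map $\delta:E(G)\to\{\text{red},\text{blue}\}$ (incident edges may have the same colour) that is surjective and such that for each cycle of $G$ either all edges have the same colour or there are at least two red and at least two blue edges. A red component is a connected component of the graph $(V(G),\{e\in E(G):\delta(e)=\text{red}\})$ (isolated vertices included); blue components are defined analogously. A red or blue component $H$ is partially invariant if $\gamma H=H$ for some $\gamma\in\mathcal{C}_n\setminus\{1\}$. A NAC-colouring $\delta$ of a $\mathcal{C}_n$-symmetric graph $G$ is $\mathcal{C}_n$-symmetric if $\delta(\gamma e)=\delta(e)$ for all $e\in E(G)$, $\gamma\in\mathcal{C}_n$, and no two distinct partially invariant red components are connected by an edge of $G$, and no two distinct partially invariant blue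 components are connected by an edge of $G$. Constant distance closure. For a $\mathcal{C}_n$-symmetric graph $G$, let $\operatorname{U}_{\mathcal{C}_n}(G)$ be the set of all pairs $\{u,v\}\subset V(G)$ of distinct vertices such that $uv\notin E(G)$ and there exists a path from $u$ to $v$ in $G$ which is monochromatic for all $\mathcal{C}_n$-symmetric NAC-colourings of $G$ (vacuously true for any path if $G$ has no such colouring). Let $G_0,\dots,G_m$ be a sequence of $\mathcal{C}_n$-symmetric graphs such that $G_0=G$, $G_i=(V(G_{i-1}),E(G_{i-1})\cup \operatorname{U}_{\mathcal{C}_n}(G_{i-1}))$ for $i\in\{1,\dots,m\}$, and $\operatorname{U}_{\mathcal{C}_n}(G_m)=\emptyset$. The graph $G_m$ (with the same action of $\mathcal{C}_n$ on vertices) is the $\mathcal{C}_n$-symmetric constant distance closure $\operatorname{CDC}_{\mathcal{C}_n}(G)$ of $G$; as in this definition, all graphs $G_i$ in the sequence are $\mathcal{C}_n$-symmetric. *)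

(* Defs.v *)
From HB Require Import structures.
From mathcomp Require Import all_boot all_order all_algebra all_fingroup.
From mathcomp Require Import all_classical all_reals all_analysis.
Import Order.TTheory GRing.Theory Num.Theory numFieldNormedType.Exports.

Set Implicit Arguments.
Unset Strict Implicit.
Unset Printing Implicit Defensive.

Local Open Scope ring_scope.

Section Graphs.
Variable V : finType.

Record sgraph := SGraph {
  edges : {set {set V}};
  edges_card2 : forall e, e \in edges -> #|e| = 2%N }.

Definition adj (G : sgraph) : rel V := fun u v => [set u; v]%SET \in edges G.

Definition complete_graph (G : sgraph) : Prop :=
  forall u v : V, u != v -> adj G u v.

Definition graph_aut (G : sgraph) : {set {perm V}} :=
  [set s : {perm V} | [set (s @: e)%SET | e : {set V} in edges G]%SET == edges G]%SET.

Definition is_cycle (G : sgraph) (c : seq V) : Prop :=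
  [/\ (3 <= size c)%N, uniq c & path.cycle (adj G) c].

Definition cycle_edges (c : seq V) : seq {set V} :=
  [seq [set x; next c x]%SET | x <- c].

Definition is_path (G : sgraph) (u v : V) (s : seq V) : Prop :=
  [/\ path (adj G) u s, last u s = v & uniq (u :: s)].

Definition path_edges (u : V) (s : seq V) : seq {set V} :=
  pairmap (fun x y => [set x; y]%SET) u s.

Definition colour := bool.
Definition red : colour := true.
Definition blue : colour := false.

(* A colouring of E(G) is given by a total function on sets of vertices; only
   its values on E(G) are ever used. *)
Definition colouring := {set V} -> colour.

Definition is_NAC (G : sgraph) (delta : colouring) : Prop :=
  (forall a : colour, exists2 e, e \in edges G & delta e = a) /\
  (forall c : seq V, is_cycle G c ->
     (exists a : colour, forall e : {set V}, e \in cycle_edges c -> delta e = a) \/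
     (forall a : colour, (2 <= count (fun e => delta e == a) (cycle_edges c))%N)).

Definition colour_adj (G : sgraph) (delta : colouring) (a : colour) : rel V :=
  fun u v => adj G u v && (delta [set u; v]%SET == a).

(* Components are represented by their vertex sets. *)
Definition components (G : sgraph) (delta : colouring) (a : colour) :
    {set {set V}} :=
  [set [set u | connect (colour_adj G delta a) v u]%SET | v : V]%SET.

End Graphs.

Section Symmetry.
Local Open Scope group_scope.
(* The group C_n is the cycle <[w]> with #[w] = n; theta is its action. *)
Variables (gT : finGroupType) (w : gT) (V : finType).
Variable theta : {morphism <[w]> >-> {perm V}}.

Definition invariant_vertex (v : V) : Prop :=
  forall g, g \in <[w]> -> theta g v = v.

Definition partially_invariant_vertex (v : V) : Prop :=
  exists g, [/\ g \in <[w]>, g != 1 & theta g v = v].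

Definition Cn_symmetric_graph (G : sgraph V) : Prop :=
  [/\ 'injm theta,
      theta @* <[w]> \subset graph_aut G,
      forall v, partially_invariant_vertex v -> invariant_vertex v
    & forall u v, invariant_vertex u -> invariant_vertex v -> ~~ adj G u v].

Definition partially_invariant_component (H : {set V}) : Prop :=
  exists g, [/\ g \in <[w]>, g != 1 & (theta g @: H)%SET = H].

(* When the first two conditions hold, [theta g] maps monochromatic components
   to monochromatic components, so comparing vertex sets in
   [partially_invariant_component] amounts to comparing subgraphs. *)
Definition Cn_symmetric_NAC (G : sgraph V) (delta : colouring V) : Prop :=
  [/\ is_NAC G delta,
      forall g e, g \in <[w]> -> e \in edges G ->
        delta (theta g @: e)%SET = delta e
    & forall (a : colour) (H K : {set V}),
        H \in components G delta a -> K \in components G delta a ->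
        partially_invariant_component H -> partially_invariant_component K ->
        H != K ->
        forall u v, u \in H -> v \in K -> ~~ adj G u v].

Definition U_Cn (G : sgraph V) : {set {set V}} :=
  [set e : {set V} | `[< exists u v : V,
     [/\ e = [set u; v]%SET, u != v, e \notin edges G
       & exists2 s : seq V, is_path G u v s &
           forall delta, Cn_symmetric_NAC G delta ->
             exists a : colour, forall f : {set V}, f \in path_edges u s -> delta f = a]
   >]]%SET.

(* [H] is the C_n-symmetric constant distance closure of [G]. *)
Definition is_CDC_Cn (G H : sgraph V) : Prop :=
  exists (m : nat) (Gs : nat -> sgraph V),
    [/\ Gs 0%N = G,
        forall i, (i <= m)%N -> Cn_symmetric_graph (Gs i),
        forall i, (i < m)%N ->
          edges (Gs i.+1) = (edges (Gs i) :|: U_Cn (Gs i))%SET,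
        U_Cn (Gs m) = finset.set0
      & Gs m = H].

End Symmetry.

Section Frameworks.
Variables (R : realType) (V : finType).

(* The library norm on matrices is the sup norm. *)
Definition enorm (x : 'cV[R]_2) : R := Num.sqrt (\sum_i x i 0 ^+ 2).

Definition is_placement (G : sgraph V) (p : V -> 'cV[R]_2) : Prop :=
  forall u v, adj G u v -> p u <> p v.

Definition equivalent (G : sgraph V) (p q : V -> 'cV[R]_2) : Prop :=
  forall u v, adj G u v -> enorm (p u - p v) = enorm (q u - q v).

Definition congruent (p q : V -> 'cV[R]_2) : Prop :=
  forall u v, enorm (p u - p v) = enorm (q u - q v).

Definition is_flex (G : sgraph V) (p : V -> 'cV[R]_2)
    (P : R -> V -> 'cV[R]_2) : Prop :=
  [/\ forall v, {within `[0, 1], continuous (fun t => P t v)}%classic,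
      forall t : R, 0 <= t <= 1 -> is_placement G (P t),
      P 0 = p
    & forall t : R, 0 <= t <= 1 -> equivalent G (P t) p].

Definition trivial_flex (p : V -> 'cV[R]_2) (P : R -> V -> 'cV[R]_2) : Prop :=
  forall t : R, 0 <= t <= 1 -> congruent (P t) p.

Definition rotation (a : R) : 'M[R]_2 :=
  \matrix_(i, j) if i == j then cos a
                 else if i == 0 then - sin a else sin a.

Definition tau (n k : nat) : 'M[R]_2 := rotation (2 * k%:R * pi / n%:R).

Variables (n : nat) (gT : finGroupType) (w : gT).
Variable theta : {morphism <[w]>%g >-> {perm V}}.

Definition Cn_symmetric_placement (G : sgraph V) (p : V -> 'cV[R]_2) : Prop :=
  is_placement G p /\
  forall (k : nat) (v : V), p (theta (w ^+ k)%g v) = tau n k *m p v.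

(* [n] is the order of [w]. *)
Definition proper_Cn_symmetric_flexible (G : sgraph V) (p : V -> 'cV[R]_2) :
    Prop :=
  Cn_symmetric_placement G p /\
  exists P : R -> V -> 'cV[R]_2,
    [/\ is_flex G p P,
        ~ trivial_flex p P,
        forall t : R, 0 <= t <= 1 -> Cn_symmetric_placement G (P t)
      & finite_set [set t : R | 0 <= t <= 1 /\ ~ injective (P t)]%classic].

End Frameworks.

(* Main.v *)
Require Import Defs.
From HB Require Import structures.
From mathcomp Require Import all_boot all_order all_algebra all_fingroup.
From mathcomp Require Import all_classical all_reals all_analysis.
From mathcomp Require Import ring lra complex.

(** A flex of the closure is also a flex of [G]. Conversely, it is enough to
    show that a flex of [G] by symmetric placements keeps constant the distance
    of every pair [u], [v] that a closure step adds. The distance is then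
    nonzero, because some placement of the flex is injective, so the flex is
    also one of the enlarged graph, and induction on the number of steps
    concludes. A complete framework has only trivial flexes.

    Identify the plane with the complex numbers, so that the symmetry acts by
    multiplication by roots of unity; write [W] for the position of a vertex
    at time [t] and [Z] for its conjugate. On each edge, the product of the
    differences of [W] and of [Z] is the squared length, which does not depend
    on [t]. Let [u] and [v] be joined by a path that all symmetric
    NAC-colourings make monochromatic, let [ab] be its first edge and [cd]
    another one, and let [y] be the product of [W c - W d] and [Z a - Z b]. If
    [y] is constant in [t] for all edges [cd] of the path, then so is the
    product of [W u - W v] and [Z a - Z b], hence the distance from [u] to [v]
    (monochromatic_path_constant).

    Suppose that some [y] is not constant. Let [k] be the subfield generated
    by the squared lengths, the roots of unity and their conjugates. It is
    countable, whereas the continuous function [y] takes uncountably many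
    values, so there is a time at which [y] is transcendental over [k]
    (constant_of_algebraic). Fix that time. By a maximality argument the
    complex field has a valuation that is trivial on [k] and positive on [y]
    (place_of_transcendental). Colour an edge red when [W] has larger valuation
    on it than on [ab], and blue otherwise; then [ab] is blue and [cd] is red.
    This is a symmetric NAC-colouring (sym_NAC_of_place), which contradicts the
    choice of the path. Indeed, since the product of [W] and [Z] on an edge has
    valuation 0, each colour is characterised by a lower bound on a valuation:
    of [W] for red, of [Z] for blue. By the ultrametric inequality each of the
    two bounds defines an equivalence relation on the vertices, which is what
    the condition on cycles amounts to (NAC_of_equivalences). These relations
    are invariant under rotation, and a class that a nontrivial rotation moves
    to itself contains the centre, so that no two distinct partially invariant
    components of one colour can be adjacent. *)

Import Order.TTheory GRing.Theory Num.Theory numFieldNormedType.Exports.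
Set Implicit Arguments.
Unset Strict Implicit.
Unset Printing Implicit Defensive.
Local Open Scope classical_set_scope.
Local Open Scope ring_scope.

(** * Subrings of a field *)

Definition is_subring (K : nzRingType) (A : set K) : Prop :=
  [/\ A 1, forall x y, A x -> A y -> A (x - y)
    & forall x y, A x -> A y -> A (x * y)].

Section Subrings.
Variables (K : nzRingType) (A : set K).
Hypothesis Aring : is_subring A.

Lemma subring1 : A 1. Proof. by case: Aring. Qed.
Lemma subringB x y : A x -> A y -> A (x - y).
Proof. by case: Aring => _ + _; apply. Qed.
Lemma subringM x y : A x -> A y -> A (x * y).
Proof. by case: Aring => _ _; apply. Qed.
Lemma subring0 : A 0.
Proof. by rewrite -(subrr 1); apply: subringB; exact: subring1. Qed.
Lemma subringN x : A x -> A (- x).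
Proof. by move=> Ax; rewrite -sub0r; exact: subringB subring0 Ax. Qed.
Lemma subringD x y : A x -> A y -> A (x + y).
Proof. by move=> Ax Ay; rewrite -[y]opprK; exact: subringB Ax (subringN Ay). Qed.
Lemma subringX x n : A x -> A (x ^+ n).
Proof.
move=> Ax; elim: n => [|n IHn]; first exact: subring1.
by rewrite exprS; exact: subringM.
Qed.
Lemma subring_sum (I : Type) (r : seq I) (P : pred I) (F : I -> K) :
  (forall i, P i -> A (F i)) -> A (\sum_(i <- r | P i) F i).
Proof. by move=> AF; apply: big_ind => //; [exact: subring0|exact: subringD]. Qed.

Definition coefs_in : set {poly K} := [set p | forall i, A p`_i].

Lemma coefs_in_subring : is_subring coefs_in.
Proof.
split=> [i|p q Ap Aq i|p q Ap Aq i].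
- by rewrite coef1; case: eqP => _; [exact: subring1|exact: subring0].
- by rewrite coefB; exact: subringB.
- by rewrite coefM; apply: subring_sum => j _; exact: subringM.
Qed.

Lemma coefs_inC c : A c -> coefs_in c%:P.
Proof. by move=> Ac i; rewrite coefC; case: eqP => _ //; exact: subring0. Qed.

Lemma coefs_inX : coefs_in 'X.
Proof. by move=> i; rewrite coefX; case: eqP => _; [exact: subring1|exact: subring0]. Qed.

End Subrings.

Definition adjoin (K : nzRingType) (A : set K) (x : K) : set K :=
  [set p.[x] | p in coefs_in A].

Section Adjoin.
Variables (K : fieldType) (A : set K).
Hypothesis Aring : is_subring A.

Lemma adjoin_subring x : is_subring (adjoin A x).
Proof.
have Ar := coefs_in_subring Aring.
split=> [|_ _ [p Ap <-] [q Aq <-]|_ _ [p Ap <-] [q Aq <-]].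
- by exists 1; [exact: (subring1 Ar)|rewrite hornerC].
- by exists (p - q); [exact: (subringB Ar)|rewrite !hornerE].
- by exists (p * q); [exact: (subringM Ar)|rewrite !hornerE].
Qed.

Lemma sub_adjoin x : A `<=` adjoin A x.
Proof. by move=> c Ac; exists c%:P; [exact: coefs_inC|rewrite hornerC]. Qed.

Lemma adjoin_gen x : adjoin A x x.
Proof. by exists 'X; [exact: coefs_inX Aring|rewrite hornerX]. Qed.

End Adjoin.

Lemma expr_mulVX (K : fieldType) (y : K) (i n : nat) :
  y != 0 -> (i <= n)%N -> y ^+ n * y^-1 ^+ i = y ^+ (n - i).
Proof. by move=> /negPf y0 le_in; rewrite exprVn expfB_cond ?y0. Qed.

(** * Valuation subrings by maximality *)

Section MaximalSubring.
Variables (K : fieldType) (x : K).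

(** If moreover [A] is maximal for these properties, then it is a valuation
    subring of [K] and [x] is a nonunit of it, that is, [x] has positive
    valuation. *)
Definition avoiding (A : set K) : Prop := [/\ is_subring A, A x & ~ A x^-1].

Variable A : set K.
Hypothesis Aav : avoiding A.
Hypothesis Amax : forall B, avoiding B -> A `<=` B -> B = A.

Let Aring : is_subring A. Proof. by case: Aav. Qed.
Let Ax : A x. Proof. by case: Aav. Qed.
Let AVx : ~ A x^-1. Proof. by case: Aav. Qed.
Let x0 : x != 0.
Proof. by apply/eqP => x0; apply: AVx; rewrite x0 invr0 -x0. Qed.

Lemma maximal_mem y : ~ adjoin A y x^-1 -> A y.
Proof.
move=> nVx; suff <- : adjoin A y = A by exact: adjoin_gen.
apply: Amax; last exact: sub_adjoin.
by split=> //; [exact: adjoin_subring|exact: sub_adjoin].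
Qed.

(** Inverting [1 - x * b] cannot make [x] invertible: a fraction equal to
    [x^-1] would have a denominator [d ^+ N] that is 1 modulo [x A], and
    clearing it would already put [x^-1] in [A]. *)
Lemma maximal_unit b : A b -> A (1 - x * b)^-1.
Proof.
move=> Ab; set d := 1 - x * b.
have Ad : A d by apply: subringB => //; [exact: subring1|exact: subringM].
have d0 : d != 0.
  apply/eqP => /subr0_eq /esym xb; apply: AVx.
  by rewrite -[x^-1]mulr1 -xb mulKf.
apply: maximal_mem => -[p Ap pd].
(* The exponent [size p] exceeds the degree of [p], so this power of [d] clears
   the denominators of [p.[d^-1]]. *)
have [N [c Ac dN]] : exists N, exists2 c, A c & c = d ^+ N * p.[d^-1].
  exists (size p); exists (d ^+ size p * p.[d^-1]) => //.
  rewrite horner_coef mulr_sumr; apply: subring_sum => // i _.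
  rewrite mulrCA expr_mulVX ?(ltnW (ltn_ord i)) //.
  by apply: subringM => //; exact: subringX.
rewrite pd in dN.
have [e Ae eN] : exists2 e, A e & d ^+ N = 1 - x * e.
  elim: N {dN} => [|N [e Ae IH]].
    by exists 0; [exact: subring0|rewrite expr0 mulr0 subr0].
  exists (b + e - x * b * e); last by rewrite exprS IH /d; ring.
  apply: subringB => //; first exact: subringD.
  by apply: subringM => //; exact: subringM.
apply: AVx; suff -> : x^-1 = c + e by exact: subringD.
by rewrite dN eN mulrBl mul1r mulrAC mulfV // mul1r subrK.
Qed.

(** The algebraic core: [x] cannot be invertible both in [A[y]] and in
    [A[y^-1]]. Otherwise take the relations [p] and [q] expressing this, with
    [size q <= size p] by symmetry. As [1 - x * q`_0] is a unit of [A], the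
    relation [q] makes the power of [y] of exponent [deg p] an
    [A]-combination of lower powers, which lowers the degree of [p]. *)
Lemma maximal_no_relations N (y : K) (p q : {poly K}) :
  (size p + size q <= N)%N -> y != 0 -> coefs_in A p -> coefs_in A q ->
  x * p.[y] = 1 -> x * q.[y^-1] = 1 -> False.
Proof.
elim: N y p q => [|N IHN] y p q.
  rewrite leqn0 addn_eq0 size_poly_eq0 => /andP[/eqP-> _] _ _ _.
  by rewrite horner0 mulr0 => /esym/eqP; rewrite oner_eq0.
wlog le_qp : y p q / (size q <= size p)%N.
  move=> WL; have [|/ltnW] := leqP (size q) (size p); first exact: WL.
  move=> le_pq szN y0 Ap Aq xp xq.
  by apply: (WL y^-1 q p); rewrite ?invr_eq0 ?invrK // addnC.
move=> szN y0 Ap Aq xp xq.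
case: (posnP (size p)) => [/eqP|p_gt0].
  rewrite size_poly_eq0 => /eqP p0; move: xp.
  by rewrite p0 horner0 mulr0 => /esym/eqP; rewrite oner_eq0.
set n := (size p).-1; have Sn : n.+1 = size p by rewrite /n prednK.
pose u := (1 - x * q`_0)^-1.
have Au : A u by exact: maximal_unit.
(* [s] is the reversal of [q], so that [s.[y] = y ^+ n * q.[y^-1]] *)
pose s : {poly K} := \poly_(j < n.+1) q`_(n - j).
have sy : x * s.[y] = y ^+ n.
  rewrite -[RHS]mulr1 -xq mulrCA; congr (x * _).
  have le_qn : (size q <= n.+1)%N by rewrite Sn.
  rewrite horner_poly (horner_coef_wide _ le_qn) mulr_sumr.
  rewrite (reindex_inj rev_ord_inj); apply: eq_bigr => i _ /=.
  have le_in : (i <= n)%N by rewrite -ltnS.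
  by rewrite subSS subKn // mulrCA expr_mulVX.
have As : coefs_in A s.
  by move=> i; rewrite coef_poly; case: ifP => _ //; exact: subring0.
(* [y] is a root of [t], whose coefficient in degree [n] is the unit of
   inverse [u]: subtracting a multiple of [t] removes the top term of [p]. *)
pose t := 'X^n - x *: s.
have ty : t.[y] = 0 by rewrite !hornerE sy subrr.
have At : coefs_in A t.
  move=> i; rewrite coefB coefXn coefZ; apply: subringB => //.
    by case: eqP => _; [exact: subring1|exact: subring0].
  exact: subringM.
have tn : t`_n = 1 - x * q`_0.
  by rewrite coefB coefXn eqxx coefZ coef_poly ltnSn subnn.
have tn0 : 1 - x * q`_0 != 0.
  apply/eqP => /subr0_eq /esym xb; apply: AVx.
  by rewrite -[x^-1]mulr1 -xb mulKf.
pose r := p - (p`_n * u) *: t.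
have sz_r : (size r <= n)%N.
  apply/leq_sizeP => j; rewrite leq_eqVlt => /orP[/eqP <-|lt_nj].
    by rewrite coefB coefZ tn -mulrA mulVf // mulr1 subrr.
  rewrite coefB coefZ (nth_default 0) -?Sn // coefB coefXn gtn_eqF // coefZ.
  by rewrite coef_poly ltnS leqNgt lt_nj /= !(mulr0, subr0).
apply: (IHN y r q) => //.
- by rewrite -ltnS (leq_trans _ szN) // -Sn addSn !ltnS leq_add2r.
- move=> i; rewrite coefB coefZ; apply: subringB => //.
  by do 2?apply: subringM.
- by rewrite hornerD hornerN hornerZ ty mulr0 subr0.
Qed.

Lemma maximal_valuation y : A y \/ A y^-1.
Proof.
have [->|y0] := eqVneq y 0; first by left; exact: subring0.
have [[q Aq qy]|] := pselect (adjoin A y^-1 x^-1); last first.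
  by move=> /maximal_mem; right.
have [[p Ap py]|] := pselect (adjoin A y x^-1); last first.
  by move=> /maximal_mem; left.
case: (@maximal_no_relations _ y p q (leqnn _)) => //.
- by rewrite py mulfV.
- by rewrite qy mulfV.
Qed.

End MaximalSubring.

Lemma exists_valuation_subring (K : fieldType) (x : K) (A0 : set K) :
  avoiding x A0 ->
  exists O, [/\ avoiding x O, A0 `<=` O & forall y, O y \/ O y^-1].
Proof.
move=> A0av.
(* The empty set is admitted because the union of the empty chain is empty. *)
pose P (A : set K) := A = set0 \/ (avoiding x A /\ A0 `<=` A).
have [|O [PO Omax]] := @Zorn_bigcup K P.
  move=> F FP Ftot; have [[X0 [FX0 X00]]|F0] :=
      pselect (exists X, F X /\ X !=set0); last first.
    left; rewrite -subset0 => y [X FX Xy]; apply: F0.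
    by exists X; split => //; exists y.
  have FP' X : F X -> X !=set0 -> avoiding x X /\ A0 `<=` X.
    by move=> FX [z Xz]; case: (FP _ FX) => // X_0; rewrite X_0 in Xz.
  have [[X0r X0x _] A0X0] := FP' _ FX0 X00.
  have dir y z : (\bigcup_(X in F) X) y -> (\bigcup_(X in F) X) z ->
      exists X, [/\ F X, is_subring X, X y & X z].
    move=> [X FX Xy] [Y FY Yz].
    case: (Ftot _ _ FX FY) => XY; [exists Y|exists X]; split => //.
    - by have [|[]] := FP' _ FY; first by exists z.
    - exact: XY.
    - by have [|[]] := FP' _ FX; first by exists y.
    - exact: XY.
  right; split; last by move=> a /A0X0; exists X0.
  split.
  - split; first by exists X0 => //; case: X0r.
    + by move=> y z /dir h /h [X [FX Xr Xy Xz]]; exists X => //; exact: subringB.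
    + by move=> y z /dir h /h [X [FX Xr Xy Xz]]; exists X => //; exact: subringM.
  - by exists X0.
  - move=> [X FX Xx]; have [|[_ _ nX] _] := FP' _ FX; first by exists x^-1.
    exact: nX.
have A0x : A0 x by case: A0av.
case: PO => [defO|[avO A0O]].
  exfalso; apply: (Omax A0); last by right; split.
  by rewrite defO; split=> [y []|/(_ _ A0x)].
exists O; split=> //; apply: (maximal_valuation avO) => B Bav OB.
apply: contrapT => BO; apply: (Omax B); last first.
  by right; split=> //; exact: subset_trans OB.
by split=> // BO'; apply: BO; apply/seteqP.
Qed.

(** * Transcendental elements and countable subfields *)

Definition algebraic_over (K : fieldType) (k : set K) : set K :=
  [set x | exists2 p, p != 0 & coefs_in k p /\ root p x].

(** The transcendence of [x] says that [x] is not invertible in [k[x]], which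
    is all that is needed to start the maximality argument from [k[x]]. *)
Lemma place_of_transcendental (K : fieldType) (k : set K) (x : K) :
  is_subring k -> ~ algebraic_over k x ->
  exists O, [/\ avoiding x O, k `<=` O & forall y, O y \/ O y^-1].
Proof.
move=> kr xtr; have kXr := coefs_in_subring kr.
have x0 : x != 0.
  apply/eqP => x0; apply: xtr; exists 'X; first by rewrite polyX_eq0.
  by split; [exact: (coefs_inX kr)|rewrite x0 /root hornerX].
have [|O [avO AO Oval]] := @exists_valuation_subring K x (adjoin k x).
  split; [exact: adjoin_subring|exact: adjoin_gen|move=> [p kp px]].
  apply: xtr; exists ('X * p - 1).
    apply/eqP => /(congr1 (horner^~ 0)) /eqP /=.
    by rewrite hornerD hornerN hornerM hornerX hornerC horner0 mul0r sub0r oppr_eq0 oner_eq0.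
  split; last by rewrite /root !hornerE px mulfV // subrr.
  apply: (subringB kXr); last exact: (subring1 kXr).
  by apply: (subringM kXr) => //; exact: (coefs_inX kr).
by exists O; split=> // y ky; apply: AO; exact: sub_adjoin.
Qed.

Section CountableSubfield.
Variables (I : countType) (K : closedFieldType) (c : I -> K).

(** Trees with leaves in a countable type form a countable type; read as
    arithmetic expressions in the [c i], they name all the elements of the
    subfield generated by the [c i]. The malformed ones denote 1. *)
Fixpoint eval_tree (t : GenTree.tree I) : K :=
  match t with
  | GenTree.Leaf i => c i
  | GenTree.Node 0 [:: a; b] => eval_tree a - eval_tree b
  | GenTree.Node 1 [:: a; b] => eval_tree a * eval_tree b
  | GenTree.Node 2 [:: a] => (eval_tree a)^-1
  | _ => 1
  end.

Definition generated_subfield : set K := range eval_tree.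

Lemma generated_subfield_subring : is_subring generated_subfield.
Proof.
split; first by exists (GenTree.Node 0 [::]).
- by move=> _ _ [a _ <-] [b _ <-]; exists (GenTree.Node 0 [:: a; b]).
- by move=> _ _ [a _ <-] [b _ <-]; exists (GenTree.Node 1 [:: a; b]).
Qed.

Lemma generated_subfieldV x : generated_subfield x -> generated_subfield x^-1.
Proof. by move=> [a _ <-]; exists (GenTree.Node 2 [:: a]). Qed.

Lemma generated_subfield_gen i : generated_subfield (c i).
Proof. by exists (GenTree.Leaf i). Qed.

(** There are countably many polynomials over a countable subfield, each with
    finitely many roots. *)
Lemma countable_algebraic : countable (algebraic_over generated_subfield).
Proof.
pose P (s : seq (GenTree.tree I)) : {poly K} := Poly (map eval_tree s).
apply: (@sub_countable _ _ _ (\bigcup_(s in [set s | P s != 0]) [set x | root (P s) x])).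
  apply: subset_card_le => x [p p0 [kp px]].
  have [f fP] : {f : nat -> GenTree.tree I & forall i, eval_tree (f i) = p`_i}.
    have /choice[f fP] : forall i, exists t, eval_tree t = p`_i.
      by move=> i; case: (kp i) => t _ <-; exists t.
    by exists f.
  have Pp : P (mkseq f (size p)) = p.
    rewrite /P -map_comp -[RHS]polyseqK; congr Poly.
    rewrite -[RHS](mkseq_nth 0); apply: eq_map => i /=; exact: fP.
  by exists (mkseq f (size p)); rewrite /= Pp.
apply: bigcup_countable => // s /= Ps0.
have [r rE] := closed_field_poly_normal (P s).
suff -> : [set x | root (P s) x] = [set` r].
  by apply: finite_set_countable; exact: finite_seq.
apply/seteqP; split=> x /=.
  by rewrite rE rootZ ?lead_coef_eq0 // root_prod_XsubC.
by rewrite rE rootZ ?lead_coef_eq0 // root_prod_XsubC.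
Qed.

End CountableSubfield.

(** * NAC-colourings from equivalence relations *)

Section Equivalences.
Variables (V : finType) (E : V -> V -> Prop).
Hypotheses (E_refl : forall x, E x x)
  (E_trans : forall y x z, E x y -> E y z -> E x z).

Lemma connect_related (e : rel V) u v :
  (forall x y, e x y -> E x y) -> connect e u v -> E u v.
Proof.
move=> eE /connectP[s es ->]; elim: s u es => //= x s IHs u /andP[/eE ux /IHs].
exact: E_trans.
Qed.

Lemma fpath_related (f : V -> V) s y z :
  fpath f y (rcons s z) -> (forall x, x \in y :: s -> E x (f x)) -> E y z.
Proof.
elim: s y => [|x s IHs] y /= /andP[/eqP fy pths] Ef.
  by rewrite -fy; apply: Ef; rewrite mem_head.
apply: (E_trans (y := x)); first by rewrite -fy; apply: Ef; rewrite mem_head.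
by apply: IHs => // w ws; apply: Ef; rewrite inE ws orbT.
Qed.

(** Going around the cycle from the successor of [x0] back to [x0] uses every
    edge but the one that leaves [x0]. *)
Lemma cycle_closes_up (c : seq V) x0 :
  uniq c -> x0 \in c ->
  (forall x, x \in c -> x != x0 -> E x (next c x)) -> E (next c x0) x0.
Proof.
move=> Uc /rot_to[i s defc] stepE.
have Us : uniq (x0 :: s) by rewrite -defc rot_uniq.
rewrite -(next_rot i Uc) defc.
have := cycle_next Us; rewrite /path.cycle.
case: s => [|y s] in defc Us *; first by rewrite /= eqxx.
rewrite rcons_cons => /andP[/eqP-> pths].
apply: (fpath_related pths) => x xs; rewrite -defc next_rot //; apply: stepE.
  by rewrite -(mem_rot i) defc inE xs orbT.
by apply: contraTneq xs => ->; case/andP: Us.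
Qed.

End Equivalences.

Section Colourings.
Variables (V : finType) (G : sgraph V).

Lemma adj_sym : symmetric (adj G).
Proof. by move=> u v; rewrite /adj finset.setUC. Qed.

Lemma adj_neq u v : adj G u v -> u != v.
Proof.
by move=> /edges_card2 h; apply/eqP => uv; move: h; rewrite uv finset.setUid cards1.
Qed.

Lemma edgesP e : e \in edges G -> exists u v, e = [set u; v]%SET /\ adj G u v.
Proof.
move=> /[dup] eG /edges_card2 /eqP /cards2P[u [v [_ ee]]].
by exists u, v; split=> //; rewrite /adj -ee.
Qed.

(** If an edge has colour [a] exactly when its ends are related by [E a], then
    a cycle cannot have exactly one edge of colour [a]: the other edges would
    relate the two ends of that edge for the other colour. *)
Lemma NAC_of_equivalences (delta : colouring V) (E : colour -> V -> V -> Prop) :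
  (forall a x, E a x x) ->
  (forall a x y, E a x y -> E a y x) ->
  (forall a y x z, E a x y -> E a y z -> E a x z) ->
  (forall a u v, adj G u v -> (delta [set u; v]%SET = a <-> E a u v)) ->
  (forall a, exists2 e, e \in edges G & delta e = a) ->
  is_NAC G delta.
Proof.
move=> Er Es Et Eadj surj; split=> // c [_ Uc cyc].
pose d x := delta [set x; next c x]%SET.
have adjc x : x \in c -> adj G x (next c x) by exact: next_cycle.
have countE a : count (fun e => delta e == a) (cycle_edges c)
    = size [seq x <- c | d x == a].
  by rewrite /cycle_edges count_map size_filter.
apply: contrapT => /not_orP[nmono /existsNP[a]].
rewrite countE => /negP; rewrite -leqNgt => le1; apply: nmono.
have [|/hasPn noa] := boolP (has (fun x => d x == a) c); last first.
  exists (~~ a) => _ /mapP[x xc ->]; move: (noa _ xc); rewrite /d.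
  by case: (delta _) a {noa le1} => [] [].
case/hasP=> x0 x0c /eqP dx0.
suff : d x0 = ~~ a by rewrite dx0; case: (a).
apply/(Eadj _ _ _ (adjc _ x0c)); apply: (Es); apply: cycle_closes_up => //.
  exact: Et.
move=> x xc xx0; apply/(Eadj _ _ _ (adjc _ xc)).
suff : d x != a by rewrite /d; case: (delta _) (a) => [] [].
apply: contraTneq le1 => dx; rewrite -ltnNge.
have := @uniq_leq_size _ [:: x; x0] [seq x <- c | d x == a].
apply; first by rewrite /= inE xx0.
move=> z; rewrite !inE mem_filter => /orP[] /eqP ->.
  by rewrite dx eqxx.
by rewrite dx0 eqxx.
Qed.

End Colourings.

Section SymmetricColourings.
Local Open Scope group_scope.
Variables (gT : finGroupType) (w : gT) (V : finType).
Variable theta : {morphism <[w]> >-> {perm V}}.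
Variable G : sgraph V.
Hypothesis hG : Cn_symmetric_graph theta G.

Lemma adj_act g u v : g \in <[w]> -> adj G u v -> adj G (theta g u) (theta g v).
Proof.
case: hG => _ /fintype.subsetP autG _ _ gw uv.
have: theta g \in graph_aut G by apply: autG; exact: mem_morphim.
rewrite inE => /eqP defG; rewrite /adj -defG.
have ->: [set theta g u; theta g v]%SET = (theta g @: [set u; v])%SET.
  by rewrite imsetU1 imset_set1.
exact: imset_f.
Qed.

(** The last hypothesis handles partially invariant components: such a
    component moved onto itself by [g] contains some [u] and [theta g u], so
    two of them lie in one class of [E a], and an edge between them then has
    colour [a] and merges them. *)
Lemma sym_NAC_of_equivalences (delta : colouring V)
    (E : colour -> V -> V -> Prop) :
  (forall a x, E a x x) ->
  (forall a x y, E a x y -> E a y x) ->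
  (forall a y x z, E a x y -> E a y z -> E a x z) ->
  (forall a u v, adj G u v -> (delta [set u; v]%SET = a <-> E a u v)) ->
  (forall a, exists2 e, e \in edges G & delta e = a) ->
  (forall a g u v, g \in <[w]> -> E a u v -> E a (theta g u) (theta g v)) ->
  (forall a g h u v, g \in <[w]> -> g != 1 -> h \in <[w]> -> h != 1 ->
     E a u (theta g u) -> E a v (theta h v) -> E a u v) ->
  Cn_symmetric_NAC theta G delta.
Proof.
move=> Er Es Et Eadj surj Eact Einv; split.
- exact: (NAC_of_equivalences Er Es Et Eadj surj).
- move=> g e gw /edgesP[u [v [-> uv]]].
  rewrite imsetU1 imset_set1; apply/(Eadj _ _ _ (adj_act gw uv)).
  by apply: Eact => //; exact/(Eadj _ _ _ uv).
move=> a _ _ /imsetP[x _ ->] /imsetP[y _ ->].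
have colE z t : connect (colour_adj G delta a) z t -> E a z t.
  apply: connect_related => // [|r s /andP[rs /eqP]]; first exact: Et.
  by move/(Eadj _ _ _ rs).
have invE z t g : g \in <[w]> ->
    (theta g @: [set u | connect (colour_adj G delta a) z u])%SET
      = [set u | connect (colour_adj G delta a) z u]%SET ->
    connect (colour_adj G delta a) z t -> E a t (theta g t).
  move=> gw gH zt; apply: (Et _ z); first exact/Es/colE.
  have : theta g t \in [set u | connect (colour_adj G delta a) z u]%SET.
    by rewrite -gH; apply: imset_f; rewrite inE.
  by rewrite inE; exact: colE.
move=> [g [gw g1 gH]] [h [hw h1 hK]] neqHK u v; rewrite !inE => xu yv.
apply/negP => uv; case/eqP: neqHK.
have Euv : E a u v by apply: (Einv a g h); rewrite //; [exact: invE gH xu|exact: invE hK yv].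
have csym : connect_sym (colour_adj G delta a).
  by apply: sym_connect_sym => r s; rewrite /colour_adj adj_sym finset.setUC.
have cuv : connect (colour_adj G delta a) u v.
  by apply: connect1; rewrite /colour_adj uv; apply/eqP/(Eadj _ _ _ uv).
have xy : connect (colour_adj G delta a) x y.
  by apply: connect_trans xu (connect_trans cuv _); rewrite csym.
by apply/setP => z; rewrite !inE (same_connect csym xy).
Qed.

End SymmetricColourings.

(** [E] is meant to be symmetric, so that the order of the ends of an edge is
    irrelevant. *)
Definition colouring_of (V : finType) (E : V -> V -> Prop) : colouring V :=
  fun e => `[< exists u v, e = [set u; v]%SET /\ E u v >].

Lemma set2_inj (T : finType) (a b c d : T) :
  [set a; b]%SET = [set c; d]%SET -> (a = c /\ b = d) \/ (a = d /\ b = c).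
Proof.
move=> e; have ha := set21 a b; have hb := set22 a b.
have hc := set21 c d; have hd := set22 c d.
move: hc hd; rewrite -{1 2}e; rewrite e in ha hb.
by case/set2P: ha => ?; case/set2P: hb => ?; subst; auto;
  move=> /set2P[] ? /set2P[] ?; subst; auto.
Qed.

Lemma colouring_ofE (V : finType) (E : V -> V -> Prop) u v :
  (forall x y, E x y -> E y x) ->
  colouring_of E [set u; v]%SET = `[< E u v >].
Proof.
move=> Es; apply/asbool_equiv_eq; split; last by exists u, v.
by move=> [x [y [/set2_inj[[-> ->]|[-> ->]] //]]]; exact: Es.
Qed.

(** * NAC-colourings from valuation subrings *)

Section MaximalIdeal.
Variables (K : fieldType) (O : set K).
Hypotheses (Oring : is_subring O) (Oval : forall y, O y \/ O y^-1).

(** The nonunits of [O]. The case of 0 is apart because [0^-1] is 0, which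
    belongs to [O]. *)
Definition max_ideal : set K := [set y | y = 0 \/ ~ O y^-1].

Lemma max_idealM c y : O c -> max_ideal y -> max_ideal (c * y).
Proof.
move=> Oc [->|nVy]; first by left; rewrite mulr0.
have [->|c0] := eqVneq c 0; first by left; rewrite mul0r.
right=> Vcy; apply: nVy; rewrite -[y^-1](mulVKf c0) -invfM.
exact: subringM.
Qed.

Lemma max_idealB y z : max_ideal y -> max_ideal z -> max_ideal (y - z).
Proof.
have [->|y0] := eqVneq y 0.
  by move=> _ mz; rewrite sub0r -mulN1r; apply: max_idealM => //; exact: (subringN Oring (subring1 Oring)).
have [->|z0] := eqVneq z 0; first by rewrite subr0.
move=> my mz; have [Oyz|Ozy] := Oval (y / z).
  rewrite -[y](divfK z0) -[X in _ - X]mul1r -mulrBl.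
  by apply: max_idealM => //; apply: subringB => //; exact: subring1.
rewrite -[z](divfK y0) -[X in X - _]mul1r -mulrBl.
apply: max_idealM => //; apply: subringB => //; first exact: subring1.
by rewrite -[z / y]invf_div.
Qed.

Lemma one_notin_max_ideal : ~ max_ideal 1.
Proof. by case=> [/eqP|]; [rewrite oner_eq0|apply; rewrite invr1; exact: subring1]. Qed.

End MaximalIdeal.

Section PotentialNAC.
Variables (gT : finGroupType) (w : gT) (V : finType).
Variable theta : {morphism <[w]>%g >-> {perm V}}.
Variable G : sgraph V.
Hypothesis hG : Cn_symmetric_graph theta G.
Variables (K : fieldType) (k : set K).
Hypotheses (kring : is_subring k) (kV : forall x, k x -> k x^-1).

(** Here the classes of colour [a] are cut out on the vertices by a function
    [phi a] to [K] modulo an additive subgroup [M a]. Since rotations multiply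
    [phi a] by elements of [k], a class moved onto itself by a nontrivial one
    must be the class of value 0, so there is only one. *)
Lemma sym_NAC_of_potentials (delta : colouring V)
    (phi : colour -> V -> K) (M : colour -> set K) :
  (forall a, M a 0) ->
  (forall a x y, M a x -> M a y -> M a (x - y)) ->
  (forall a c x, k c -> M a x -> M a (c * x)) ->
  (forall a u v, adj G u v ->
     (delta [set u; v]%SET = a <-> M a (phi a u - phi a v))) ->
  (forall a, exists2 e, e \in edges G & delta e = a) ->
  (forall a g, g \in <[w]>%g -> exists z,
     [/\ k z, forall v, phi a (theta g v) = z * phi a v
       & g != 1%g -> z != 1]) ->
  Cn_symmetric_NAC theta G delta.
Proof.
move=> M0 MB MZ Madj surj act.
have MN a x : M a x -> M a (- x) by move=> Mx; rewrite -sub0r; exact: MB.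
have MD a x y : M a x -> M a y -> M a (x + y).
  by move=> Mx My; rewrite -[y]opprK; apply/MB/MN.
apply: (@sym_NAC_of_equivalences _ _ _ _ _ hG _
          (fun a u v => M a (phi a u - phi a v))) => //.
- by move=> a x; rewrite subrr.
- by move=> a x y /MN; rewrite opprB.
- by move=> a y x z xy yz; have := MD _ _ _ xy yz; rewrite addrA subrK.
- move=> a g u v gw; have [z [kz zE _]] := act a g gw.
  by rewrite !zE -mulrBr; exact: MZ.
(* If [phi a u] and [z * phi a u] agree modulo [M a] with [z != 1], dividing
   by [1 - z], which [M a] allows, gives [phi a u] in [M a]. *)
have centre a g u : g \in <[w]>%g -> g != 1%g ->
    M a (phi a u - phi a (theta g u)) -> M a (phi a u).
  move=> gw g1; have [z [kz zE /(_ g1) z1]] := act a g gw.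
  rewrite zE -{1}[phi a u]mul1r -mulrBl => Mu.
  have z1' : 1 - z != 0 by rewrite subr_eq0 eq_sym.
  rewrite -[phi a u](mulKf z1'); apply: MZ => //; apply: kV.
  by apply: subringB => //; exact: subring1.
by move=> a g h u v gw g1 hw h1 /(centre _ _ _ gw g1) ? /(centre _ _ _ hw h1); exact: MB.
Qed.

(** Red edges are those on which [W] has larger valuation than on [ab].
    On every edge the product of the differences of [W] and [Z] is a nonzero
    constant, of valuation 0, so the blue edges are those on which the
    valuation of [Z] is at least the one on [ab]. Lower bounds for a
    valuation define additive subgroups, hence both colours come from
    potentials: [W] modulo a multiple of the maximal ideal for red, and [Z]
    modulo a multiple of [O] for blue. *)
Lemma sym_NAC_of_place (O : set K) (W Z : V -> K) (a b c d : V) :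
  is_subring O -> (forall y, O y \/ O y^-1) -> k `<=` O ->
  (forall u v, adj G u v ->
     k ((W u - W v) * (Z u - Z v)) /\ (W u - W v) * (Z u - Z v) != 0) ->
  (forall g, g \in <[w]>%g -> exists z z',
     [/\ k z /\ k z', forall v, W (theta g v) = z * W v,
         forall v, Z (theta g v) = z' * Z v
       & g != 1%g -> z != 1 /\ z' != 1]) ->
  adj G a b -> adj G c d ->
  max_ideal O ((W c - W d) * (Z a - Z b)) ->
  exists delta, [/\ Cn_symmetric_NAC theta G delta,
     delta [set a; b]%SET = blue & delta [set c; d]%SET = red].
Proof.
move=> Or Ov kO WZ act ab cd my.
set W1 := W a - W b; set Z1 := Z a - Z b.
have [kd1 d1] := WZ _ _ ab; rewrite -/W1 -/Z1 in kd1 d1.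
have [W10 Z10] : W1 != 0 /\ Z1 != 0 by move: d1; rewrite mulf_eq0 negb_or => /andP.
pose E u v := max_ideal O ((W u - W v) / W1).
have mN x : max_ideal O x -> max_ideal O (- x).
  by move=> mx; rewrite -sub0r; apply: max_idealB => //; left.
have Es u v : E u v -> E v u.
  by rewrite /E -[W v - W u]opprB mulNr => /mN.
pose phi (e : colour) := if e then W else Z.
pose M (e : colour) : set K := if e then [set x | max_ideal O (x / W1)] else [set x | O (x / Z1)].
have blueE u v : adj G u v -> ~ E u v <-> O ((Z u - Z v) / Z1).
  move=> uv; have [kd d0] := WZ _ _ uv.
  have [Wuv0 Zuv0] : W u - W v != 0 /\ Z u - Z v != 0.
    by move: d0; rewrite mulf_eq0 negb_or => /andP.
  set d2 := _ * (Z u - Z v) in kd d0.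
  have ->: (Z u - Z v) / Z1 = d2 / (W1 * Z1) * ((W u - W v) / W1)^-1.
    by rewrite /d2; field; rewrite ?W10 ?Z10 ?Wuv0.
  have VE : ~ E u v <-> O ((W u - W v) / W1)^-1.
    rewrite /E /max_ideal /=; split; first by move=> /not_orP[_ /contrapT].
    move=> OV [/eqP|//]; rewrite mulf_eq0 invr_eq0.
    by rewrite (negPf Wuv0) (negPf W10).
  have kq : k (d2 / (W1 * Z1)) by apply: subringM => //; exact: kV.
  have q0 : d2 / (W1 * Z1) != 0 by rewrite mulf_neq0 // invr_eq0.
  rewrite VE; split=> [|OZ]; first by apply: subringM => //; exact: kO.
  rewrite -[X in O X](mulKf q0); apply: subringM => //.
  exact/kO/kV.
have deltaab : colouring_of E [set a; b]%SET = blue.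
  rewrite colouring_ofE //; apply/asboolPn.
  by rewrite /E mulfV //; exact: one_notin_max_ideal.
have deltacd : colouring_of E [set c; d]%SET = red.
  rewrite colouring_ofE //; apply/asboolP; rewrite /E.
  have ->: (W c - W d) / W1 = (W1 * Z1)^-1 * ((W c - W d) * Z1).
    by field; rewrite W10 Z10.
  by apply: max_idealM => //; exact/kO/kV.
exists (colouring_of E); split=> //.
apply: (@sym_NAC_of_potentials _ phi M).
- by case; rewrite /M /= mul0r; [left|exact: subring0].
- case=> x y /=; rewrite mulrBl; first exact: max_idealB.
  exact: subringB.
- case=> r x kr /=; rewrite -mulrA; first by apply: max_idealM => //; exact: kO.
  by apply: subringM => //; exact: kO.
- move=> [] u v uv; rewrite colouring_ofE //.
    by split=> [/asboolP|?]; last exact/asboolP.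
  rewrite /M /phi /= -blueE //; by split=> [/asboolPn|?]; last exact/asboolPn.
- by case; [exists [set c; d]%SET|exists [set a; b]%SET].
- move=> e g gw; have [z [z' [[kz kz'] WE ZE zn1]]] := act g gw.
  by case: e; [exists z|exists z']; split=> // /zn1 [].
Qed.

End PotentialNAC.

(** * The complex plane *)

Section Plane.
Variable R : realType.
Local Open Scope complex_scope.

Definition to_complex (x : 'cV[R]_2) : R[i] := x 0 0 +i* x 1 0.

Lemma to_complexB x y : to_complex (x - y) = to_complex x - to_complex y.
Proof. by rewrite /to_complex !mxE. Qed.

Lemma enorm_sqr (x : 'cV[R]_2) :
  (enorm x ^+ 2)%:C = to_complex x * conjc (to_complex x).
Proof.
rewrite /enorm sqr_sqrtr; last by apply: sumr_ge0 => i _; exact: sqr_ge0.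
rewrite !big_ord_recl big_ord0 addr0 /to_complex.
have ->: lift ord0 ord0 = 1 :> 'I_2 by apply/val_inj.
by apply/eqP; rewrite eq_complex /=; apply/andP; split; apply/eqP; ring.
Qed.

Lemma enorm_eq (x y : 'cV[R]_2) :
  to_complex x * conjc (to_complex x) = to_complex y * conjc (to_complex y) ->
  enorm x = enorm y.
Proof.
rewrite -!enorm_sqr => /complexI /eqP; rewrite eqrXn2 ?sqrtr_ge0 //.
by move/eqP.
Qed.

Lemma enorm_eq0 (x : 'cV[R]_2) : enorm x = 0 -> x = 0.
Proof.
move=> x0; have := enorm_sqr x; rewrite x0 expr0n /= -sqr_normc.
move=> /esym/eqP; rewrite sqrf_eq0 normr_eq0 eq_complex /= => /andP[/eqP h0 /eqP h1].
apply/matrixP => i j; rewrite (ord1 j) mxE.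
case: i => [[|[|//]] lti] /=; [rewrite -h0|rewrite -h1]; congr (x _ _); exact/val_inj.
Qed.

Definition zeta (n k : nat) : R[i] :=
  cos (2 * k%:R * pi / n%:R) +i* sin (2 * k%:R * pi / n%:R).

Lemma to_complex_tau n k x : to_complex (tau R n k *m x) = zeta n k * to_complex x.
Proof.
rewrite /to_complex /zeta !mxE !big_ord_recl !big_ord0 !addr0 !mxE /=.
have ->: lift ord0 ord0 = 1 :> 'I_2 by apply/val_inj.
by apply/eqP; rewrite eq_complex /=; apply/andP; split; apply/eqP; ring.
Qed.

(** The cosine is [1 - 2 sin^2] of the half angle, which lies strictly between
    0 and [pi]. *)
Lemma zeta_neq1 n k : (0 < k < n)%N -> zeta n k != 1.
Proof.
move=> /andP[k0 kn]; have n0 : (0 < n)%N by exact: leq_trans kn.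
rewrite eq_complex /= negb_and; apply/orP; left.
set a := k%:R * pi / n%:R : R.
have ->: 2 * k%:R * pi / n%:R = a *+ 2 by rewrite /a mulr2n; ring.
have sa : 0 < sin a.
  apply: sin_gt0_pi; rewrite /a ?divr_gt0 ?mulr_gt0 ?pi_gt0 ?ltr0n //.
  by rewrite ltr_pdivrMr ?ltr0n // mulrC ltr_pM2l ?pi_gt0 // ltr_nat.
rewrite cos_mulr2n; apply/eqP => h.
have := cos2Dsin2 a; have : 0 < sin a ^+ 2 by rewrite exprn_gt0.
move: h; rewrite mulr2n; lra.
Qed.

End Plane.

(** * Continuous functions with countable range *)

Section ConstantOnCountable.
Variable R : realType.

Lemma uncountable_itvcc (a b : R) : a < b -> ~ countable `[a, b].
Proof.
move=> ab /countable_lebesgue_measure0; rewrite lebesgue_measure_itv /= lte_fin ab.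
by move/eqP; rewrite -EFinD eqe subr_eq0 gt_eqF.
Qed.

(** By the intermediate value theorem a nonconstant continuous function takes
    all the values of an interval, which is uncountable. *)
Lemma constant_of_countable_range (f : R -> R) :
  {within `[0, 1], continuous f} -> countable (f @` `[0, 1]) ->
  forall t, 0 <= t <= 1 -> f t = f 0.
Proof.
move=> cf cnt t /andP[t0 t1]; apply: contrapT => neq.
have cft : {within `[0, t], continuous f}.
  apply: continuous_subspaceW cf => s; rewrite /= !in_itv /= => /andP[-> st].
  exact: le_trans st t1.
pose a := Num.min (f 0) (f t); pose b := Num.max (f 0) (f t).
have ab : a < b by rewrite /a /b; case: (ltgtP (f 0) (f t)) neq => // ->.
have sub : `[a, b] `<=` f @` `[0, 1].
  move=> v; rewrite /= in_itv /= => avb.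
  have [c c0t <-] := IVT t0 cft avb.
  exists c => //; move: c0t; rewrite /= !in_itv /= => /andP[-> ct].
  exact: le_trans ct t1.
apply: (uncountable_itvcc ab).
by apply: sub_countable cnt; exact: subset_card_le.
Qed.

End ConstantOnCountable.

(** * Distances that are constant along a symmetric flex *)

Section Flex.
Local Open Scope complex_scope.
Variables (R : realType) (n : nat) (n2 : (2 <= n)%N).
Variables (gT : finGroupType) (w : gT) (wn : #[w]%g = n).
Variables (V : finType) (theta : {morphism <[w]>%g >-> {perm V}}).
Variables (G : sgraph V) (hG : Cn_symmetric_graph theta G).
Variables (p : V -> 'cV[R]_2) (P : R -> V -> 'cV[R]_2).
Hypotheses (flexP : is_flex G p P)
  (symP : forall t : R, 0 <= t <= 1 -> Cn_symmetric_placement n theta G (P t)).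

Let W t v := to_complex (P t v).

(** The quantities that do not change along the flex: the rotation factors,
    their conjugates, and the squared lengths. *)
Let consts (i : nat + nat + V * V) : R[i] :=
  match i with
  | inl (inl k) => zeta R n k
  | inl (inr k) => conjc (zeta R n k)
  | inr (u, v) => (enorm (p u - p v) ^+ 2)%:C
  end.
Let k := generated_subfield consts.

(** Only the placement at the single time [t] enters: its coordinates live in
    [R[i]], and the valuation lives on [R[i]] itself. *)
Lemma sym_NAC_of_transcendental t (a b c d : V) :
  0 <= t <= 1 -> adj G a b -> adj G c d ->
  ~ algebraic_over k ((W t c - W t d) * conjc (W t a - W t b)) ->
  exists delta, [/\ Cn_symmetric_NAC theta G delta,
     delta [set a; b]%SET = blue & delta [set c; d]%SET = red].
Proof.
move=> t01 ab cd tr.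
have kr : is_subring k by exact: generated_subfield_subring.
have kV x : k x -> k x^-1 by exact: generated_subfieldV.
have [S [[Or Oy nOy] kO Oval]] := place_of_transcendental kr tr.
have [_ _ _ eqvP] := flexP; have [plP sP] := symP t01.
pose Z v := conjc (W t v).
have ZB u v : Z u - Z v = conjc (to_complex (P t u - P t v)).
  by rewrite /Z -rmorphB /W to_complexB.
apply: (sym_NAC_of_place hG kr kV (O := S) (W := W t) (Z := Z)) => //.
- move=> u v uv; rewrite ZB /W -to_complexB -enorm_sqr; split.
    rewrite (eqvP t t01 u v uv).
    exact: (generated_subfield_gen _ (inr (u, v))).
  apply/eqP => /complexI /eqP; rewrite sqrf_eq0 => /eqP /enorm_eq0 /eqP.
  by rewrite subr_eq0 => /eqP; exact: plP.
- move=> g /cycleP[j ->].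
  have ->: (w ^+ j)%g = (w ^+ (j %% n))%g by rewrite -wn expg_mod_order.
  set i := (j %% n)%N; exists (zeta R n i), (conjc (zeta R n i)); split.
  + split; first exact: (generated_subfield_gen _ (inl (inl i))).
    exact: (generated_subfield_gen _ (inl (inr i))).
  + by move=> v; rewrite /W sP to_complex_tau.
  + by move=> v; rewrite /Z /W sP to_complex_tau rmorphM.
  + move=> wi1; have z1 : zeta R n i != 1.
      apply: zeta_neq1; rewrite ltn_mod (leq_trans _ n2) // andbT lt0n.
      by apply: contra wi1 => /eqP ->; rewrite expg0.
    split=> //; apply: contra z1 => /eqP h.
    by rewrite -[zeta R n i]conjcK h conjc1.
- by right; rewrite ZB to_complexB.
Qed.

Lemma coord_within v (i : 'I_2) :
  {within `[0, 1], continuous (fun t => P t v i 0)}.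
Proof.
have [cP _ _ _] := flexP.
apply: (@within_continuous_comp _ _ _ _ (fun t => P t v) (fun M : 'cV[R]_2 => M i 0)) => //.
by move=> x _; exact: coord_continuous.
Qed.

(** The numbers algebraic over [k] are countably many, so the real and
    imaginary parts are continuous functions with countable range. *)
Lemma constant_of_algebraic (a b c d : V) :
  (forall t : R, 0 <= t <= 1 -> algebraic_over k ((W t c - W t d) * conjc (W t a - W t b))) ->
  forall t : R, 0 <= t <= 1 ->
    (W t c - W t d) * conjc (W t a - W t b) = (W 0 c - W 0 d) * conjc (W 0 a - W 0 b).
Proof.
move=> alg t t01; set y := fun t => (W t c - W t d) * conjc (W t a - W t b).
have cnt (h : R[i] -> R) : countable [set h (y s) | s in `[0, 1]%classic].
  apply: (@sub_countable _ _ _ (h @` algebraic_over k)); last first.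
    by apply: sub_countable (countable_algebraic consts); exact: card_image_le.
  apply: subset_card_le => _ [s s01 <-]; exists (y s) => //; apply: alg.
  by move: s01; rewrite /= in_itv.
have const (h : R[i] -> R) : {within `[0, 1], continuous (fun s => h (y s))} ->
    h (y t) = h (y 0).
  by move=> cy; exact: (constant_of_countable_range cy (cnt h) t01).
apply/eqP; rewrite eq_complex; apply/andP; split; apply/eqP.
- by apply: (const (@complex.Re R)) => s; rewrite /y /W /to_complex /=;
    do ![exact: coord_within|apply: cvgD|apply: cvgM|apply: cvgN].
- by apply: (const (@complex.Im R)) => s; rewrite /y /W /to_complex /=;
    do ![exact: coord_within|apply: cvgD|apply: cvgM|apply: cvgN].
Qed.

(** For a path with first edge [ub], the products of the differences of [W]
    along its edges with the conjugate of the difference along [ub] must be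
    constant in time, otherwise some time gives a symmetric NAC-colouring that
    separates an edge of the path from [ub]. Adding them up, the product
    [Q t u v] is constant; its squared modulus is the squared distance from
    [u] to [v] times the fixed squared length of [ub]. *)
Lemma monochromatic_path_constant (u v : V) (s : seq V) :
  is_path G u v s ->
  (forall delta, Cn_symmetric_NAC theta G delta ->
     exists a : colour, forall f, f \in path_edges u s -> delta f = a) ->
  forall t : R, 0 <= t <= 1 -> enorm (P t u - P t v) = enorm (p u - p v).
Proof.
have [_ _ P0 eqvP] := flexP.
case: s => [|b s] [us <- _] mono t t01; first by rewrite /= !subrr.
have ub : adj G u b by case/andP: us.
pose Q t x y := (W t x - W t y) * conjc (W t u - W t b).
have constQ x y : adj G x y -> [set x; y]%SET \in path_edges u (b :: s) ->
    Q t x y = Q 0 x y.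
  move=> xy xys; apply: constant_of_algebraic => // r r01.
  apply: contrapT => /(sym_NAC_of_transcendental r01 ub xy)[delta [sd dub dxy]].
  have [a aE] := mono _ sd; have := aE _ xys; rewrite dxy => ra.
  by move: (aE [set u; b]%SET); rewrite mem_head dub -ra => /(_ isT).
have sumQ r x : path (adj G) x r ->
    {subset path_edges x r <= path_edges u (b :: s)} ->
    Q t x (last x r) = Q 0 x (last x r).
  elim: r x => [|y r IHr] x; first by rewrite /Q /= !subrr !mul0r.
  move=> /= /andP[xy yr] sub.
  have split_Q r' : Q r' x (last y r) = Q r' x y + Q r' y (last y r).
    by rewrite /Q -mulrDl addrA subrK.
  rewrite !split_Q; congr (_ + _).
    by apply: constQ => //; apply: sub; exact: mem_head.
  by apply: IHr => // f fr; apply: sub; rewrite inE fr orbT.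
have dE r : 0 <= r <= 1 ->
    (W r u - W r b) * conjc (W r u - W r b) = (enorm (p u - p b) ^+ 2)%:C.
  by move=> r01; rewrite /W -to_complexB -enorm_sqr (eqvP r r01 u b ub).
have z01 : 0 <= (0 : R) <= 1 by rewrite lexx ler01.
rewrite -P0; apply: enorm_eq; rewrite !to_complexB.
have d0 : (enorm (p u - p b) ^+ 2)%:C != 0.
  rewrite -P0; apply/eqP => /complexI /eqP.
  rewrite sqrf_eq0 => /eqP /enorm_eq0 /eqP; rewrite subr_eq0 => /eqP.
  by have [pl _] := symP z01; exact: pl.
apply: (mulIf d0); rewrite -{1}(dE t t01) -(dE 0 z01).
have norm_sq r : Q r u (last u (b :: s)) * conjc (Q r u (last u (b :: s))) =
    (W r u - W r (last u (b :: s))) * conjc (W r u - W r (last u (b :: s))) *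
    ((W r u - W r b) * conjc (W r u - W r b)).
  rewrite /Q; move: (W r u - W r (last _ _)) (W r u - W r b) => x y.
  by rewrite rmorphM /= conjcK; ring.
by rewrite -!norm_sq sumQ.
Qed.

End Flex.

(** * Flexes of the closure *)

Section Closure.
Variables (R : realType) (n : nat) (n2 : (2 <= n)%N).
Variables (gT : finGroupType) (w : gT) (wn : #[w]%g = n).
Variables (V : finType) (theta : {morphism <[w]>%g >-> {perm V}}).

Lemma proper_flexible_subgraph (G H : sgraph V) (p : V -> 'cV[R]_2) :
  edges G \subset edges H ->
  proper_Cn_symmetric_flexible n theta H p ->
  proper_Cn_symmetric_flexible n theta G p.
Proof.
move=> /fintype.subsetP GH [[plp symp] [P [[cP plP P0 eqP] ntP symP injP]]].
split; first by split=> // u v /GH; exact: plp.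
exists P; split=> //.
  split=> // [t t01 u v /GH|t t01 u v /GH]; first exact: plP.
  exact: eqP.
by move=> t /symP[pl sP]; split=> // u v /GH; exact: pl.
Qed.

(** The same flex works for [H]. The ends of an added edge stay at constant
    distance, and that distance is nonzero because the placements in the flex
    are injective at all but finitely many times, hence at some time. *)
Lemma proper_flexible_closure_step (G H : sgraph V) (p : V -> 'cV[R]_2) :
  Cn_symmetric_graph theta G ->
  edges H = (edges G :|: U_Cn theta G)%SET ->
  proper_Cn_symmetric_flexible n theta G p ->
  proper_Cn_symmetric_flexible n theta H p.
Proof.
move=> hG HE [[plp symp] [P [flexP ntP symP injP]]].
have [cP plP P0 eqvP] := flexP.
have [t0 t001 inj0] : exists2 t0 : R, 0 <= t0 <= 1 & injective (P t0).
  apply: contrapT => noinj.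
  apply: (@uncountable_itvcc R 0 1 ltr01); apply: finite_set_countable.
  apply: sub_finite_set injP => t; rewrite /= in_itv /= => t01.
  by split=> // injt; apply: noinj; exists t.
have dist t u v : 0 <= t <= 1 -> adj H u v ->
    enorm (P t u - P t v) = enorm (p u - p v).
  rewrite /adj HE inE => t01 /orP[uv|]; first exact: eqvP.
  rewrite inE => /asboolP[x [y [xyE _ _ [s pths mono]]]].
  have cst := monochromatic_path_constant n2 wn hG flexP symP pths mono t01.
  have enormN (a : 'cV[R]_2) : enorm (- a) = enorm a.
    by rewrite /enorm; congr Num.sqrt; apply: eq_bigr => i _; rewrite mxE sqrrN.
  have [[-> ->]|[-> ->]] := set2_inj xyE; first exact: cst.
  by rewrite -[P t y - _]opprB -[p y - _]opprB !enormN.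
have pl t : 0 <= t <= 1 -> is_placement H (P t).
  move=> t01 u v uv Puv; have := dist _ _ _ t01 uv.
  rewrite Puv subrr -(dist _ _ _ t001 uv) => h.
  have : u = v.
    apply: inj0; apply/eqP; rewrite -subr_eq0; apply/eqP/enorm_eq0.
    by rewrite -h /enorm big1 ?sqrtr0 // => i _; rewrite mxE expr0n.
  by apply/eqP; exact: adj_neq uv.
have z01 : 0 <= (0 : R) <= 1 by rewrite lexx ler01.
split; first by split=> //; rewrite -P0; exact: pl.
exists P; split=> //; first by split=> // t t01 u v; exact: dist.
by move=> t t01; have [_ sP] := symP _ t01; split=> //; exact: pl.
Qed.

Lemma complete_not_flexible (G : sgraph V) (p : V -> 'cV[R]_2) :
  complete_graph G -> ~ proper_Cn_symmetric_flexible n theta G p.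
Proof.
move=> cG [_ [P [[_ _ _ eqvP] ntP _ _]]]; apply: ntP => t t01 u v.
have [->|uv] := eqVneq u v; first by rewrite !subrr.
exact/eqvP/cG.
Qed.

End Closure.

Theorem theorem10 (R : realType) (n : nat) (hn : (2 <= n)%N)
    (gT : finGroupType) (w : gT) (hw : #[w]%g = n)
    (V : finType) (theta : {morphism <[w]>%g >-> {perm V}})
    (G CDC : sgraph V)
    (hG : Cn_symmetric_graph theta G)
    (hCDC : is_CDC_Cn theta G CDC) :
  ((exists p : V -> 'cV[R]_2, proper_Cn_symmetric_flexible n theta G p) <->
   (exists p : V -> 'cV[R]_2, proper_Cn_symmetric_flexible n theta CDC p)) /\
  (complete_graph CDC ->
   ~ exists p : V -> 'cV[R]_2, proper_Cn_symmetric_flexible n theta G p).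
Proof.
have flexE (p : V -> 'cV[R]_2) : proper_Cn_symmetric_flexible n theta G p <->
    proper_Cn_symmetric_flexible n theta CDC p.
  have [m [Gs [<- symGs stepGs _ <-]]] := hCDC.
  elim: m symGs stepGs => [//|m IHm] symGs stepGs.
  rewrite IHm => [|i im|i im]; first last.
  - exact/stepGs/leqW.
  - exact/symGs/leqW.
  split; first by apply: proper_flexible_closure_step => //; [exact: symGs|exact: stepGs].
  by apply: proper_flexible_subgraph; rewrite stepGs //; exact: finset.subsetUl.
split; first by split=> -[p /flexE]; exists p.
by move=> cCDC [p /flexE]; exact: complete_not_flexible.
Qed.
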